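(* Let $p\neq q$ be prime numbers. The characteristic polynomial of the weighted adjacency matrix $\mathcal A(\Gamma_E(R))$ is, for $R=\mathbb Z_p\times\mathbb Z_p\times\mathbb Z_q$, $$-(p-1)^6(q-1)^3 + (p-1)^3(q-1)\big(p(3q-2)-q\big)x^2 - 2(p-1)^2(q-1)x^3 - (p-1)\big(p(3q-2)-q\big)x^4 + x^6,$$ and, for $R=\mathbb Z_{p^2}\times\mathbb Z_p$, $$(p-1)^5p + (p-1)^3p\,x - 2(p-1)^2p\,x^2 - (p-1)x^3 + x^4 .$$ In each case the characteristic polynomial of the adjacency matrix of the zero-divisor graph $\Gamma(R)$ equals this polynomial multiplied by a power of $x$.
   Context: $\mathbb Z_n$ denotes the ring of integers modulo $n$. For a finite commutative ring $R$ with $1\ne0$, the zero-divisor graph $\Gamma(R)$ has as vertex set the set of non-zero zero-divisors of $R$, and two (not necessarily distinct) vertices $x,y$ are adjacent iff $xy=0$ (loops are kept). For $r\in R$ let $[r]_R=\{s\in R \mid \mathrm{ann}_R(r)=\mathrm{ann}_R(s)\}$, and $R_E=\{[r]_R\mid r\in R\}$. The compressed zero-divisor graph $\Gamma_E(R)$ has vertex set $R_E\setminus\{[0]_R,[1]_R\}$, with (not necessarily distinct) $[x]_R,[y]_R$ adjacent iff $xy=0$. The weighted adjacency matrix $\mathcal A(\Gamma_E(R))$ is indexed by the vertices of $\Gamma_E(R)$; its entry at $([i]_R,[j]_R)$ is $\#[j]_R$ (the number of elements of the class $[j]_R$) if $[i]_R$ and $[j]_R$ are adjacent, and $0$ otherwise.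 The characteristic polynomial of a square matrix $M$ is $\det(xI-M)$. *)

(* Defs.v *)
From HB Require Import structures.
From mathcomp Require Import all_boot all_order all_algebra.

Set Implicit Arguments.
Unset Strict Implicit.
Unset Printing Implicit Defensive.

Import GRing.Theory.
Local Open Scope ring_scope.

(* The library does not close finite commutative rings under binary products;
   this joins the existing finite and ring structures on the pair type. *)
HB.instance Definition _ (R S : finComNzRingType) :=
  GRing.ComNzRing.on (R * S)%type.

Definition zd_vertices (R : finComNzRingType) : {set R} :=
  [set x : R | (x != 0) && [exists y : R, (y != 0) && (x * y == 0)]].

(* The diagonal is not excluded: x carries a loop when x * x = 0. *)
Definition zd_adj (R : finComNzRingType) (x y : R) : bool := x * y == 0.

(* Rows and columns follow the enumeration of the vertex set given by
   [enum_val]; the characteristic polynomial does not depend on it. *)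
Definition zd_mx (R : finComNzRingType) : 'M[int]_#|zd_vertices R| :=
  \matrix_(i, j) (zd_adj (enum_val i) (enum_val j))%:R.

Definition ann (R : finComNzRingType) (r : R) : {set R} :=
  [set t : R | r * t == 0].

Definition ann_class (R : finComNzRingType) (r : R) : {set R} :=
  [set s : R | ann r == ann s].

Definition ann_classes (R : finComNzRingType) : {set {set R}} :=
  [set ann_class r | r : R].

Definition czd_vertices (R : finComNzRingType) : {set {set R}} :=
  ann_classes R :\: [set ann_class (0 : R); ann_class (1 : R)].

(* [czd_adj_class] below shows that this does not depend on the
   representatives. *)
Definition czd_adj (R : finComNzRingType) (C D : {set R}) : bool :=
  [exists x in C, exists y in D, x * y == 0].

Lemma czd_adj_class (R : finComNzRingType) (x y : R) :
  czd_adj (ann_class x) (ann_class y) = (x * y == 0).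
Proof.
have annE (a b : R) : (b \in ann a) = (a * b == 0) by rewrite inE.
apply/idP/idP => [/existsP[a /andP[+ /existsP[b /andP[+ ab0]]]]|xy0].
  rewrite !inE => /eqP xa /eqP yb.
  by rewrite -annE xa annE mulrC -annE yb annE mulrC.
apply/existsP; exists x; rewrite inE eqxx /=.
by apply/existsP; exists y; rewrite inE eqxx.
Qed.

(* The entry is weighted by the size of the class indexing the column. *)
Definition czd_mx (R : finComNzRingType) : 'M[int]_#|czd_vertices R| :=
  \matrix_(i, j)
    (if czd_adj (enum_val i) (enum_val j) then #|enum_val j|%:R else 0).

(* Main.v *)
Require Import Defs.
From mathcomp Require Import all_boot all_order all_algebra ring.

(** The adjacency matrix A of Gamma(R) depends only on the annihilator classes of
    its indices: A = S B S^T, with S the incidence matrix of vertices and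
    classes.  The weighted matrix of Gamma_E(R) is B (S^T S), so by Sylvester's
    identity det(x - XY) x^m = det(x - YX) x^n the two characteristic polynomials
    differ by a power of x.  In Z_(p^n) the class of an element is determined by
    its valuation, and in a product by the classes of the components; this
    reduces the theorem to a determinant of order 6 and one of order 4. *)

Set Implicit Arguments.
Unset Strict Implicit.
Unset Printing Implicit Defensive.

Import GRing.Theory.
Local Open Scope ring_scope.

(** * Characteristic polynomials of matrix products *)

(** The block matrix [M] is made block triangular in two ways: by a unipotent factor on the right,
    which leaves det(x - ST), and by a factor of determinant x^m on the left, which leaves x^n det(x
    - TS). No division by x occurs. *)
Lemma char_poly_mulmxC (F : comNzRingType) (n m : nat)
    (S : 'M[F]_(n, m)) (T : 'M[F]_(m, n)) :
  char_poly (S *m T) * 'X^m = char_poly (T *m S) * 'X^n.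
Proof.
rewrite /char_poly /char_poly_mx !map_mxM.
set S' := map_mx _ S; set T' := map_mx _ T.
pose M := block_mx 'X%:M S' T' 1%:M.
have detM : \det M = \det ('X%:M - S' *m T').
  rewrite -[LHS]mulr1 -[1 in LHS](_ : \det (block_mx 1%:M 0 (- T') 1%:M) = 1).
    rewrite -det_mulmx mulmx_block !mulmx1 !mulmx0 !mul1mx add0r mulmxN.
    by rewrite subrr add0r det_ublock det1 mulr1.
  by rewrite det_lblock !det1 mulr1.
have : \det (block_mx 1%:M 0 (- T') 'X%:M) * \det M =
       \det ('X%:M - T' *m S') * 'X^n.
  rewrite -det_mulmx mulmx_block !mul1mx !mul0mx !addr0 mulmx1 mulNmx.
  rewrite scalar_mxC addNr det_ublock det_scalar mulrC; congr (\det _ * _).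
  by rewrite mulNmx addrC.
by rewrite detM det_lblock det1 mul1r det_scalar mulrC.
Qed.

Lemma char_poly_fibers (F : comNzRingType) (n m : nat) (c : 'I_n -> 'I_m)
    (A : 'M[F]_n) (B : 'M[F]_m) :
  (forall i j, A i j = B (c i) (c j)) ->
  char_poly A * 'X^m =
  char_poly (\matrix_(i, j) (B i j *+ #|[set k | c k == j]|)) * 'X^n.
Proof.
move=> AE; pose S : 'M[F]_(n, m) := \matrix_(i, j) (c i == j)%:R.
have sumS (i : 'I_n) (f : 'I_m -> F) : \sum_j (c i == j)%:R * f j = f (c i).
  rewrite (bigD1 (c i)) //= eqxx mul1r big1 ?addr0 // => j.
  by rewrite eq_sym => /negPf->; rewrite mul0r.
have -> : A = S *m (B *m S^T).
  apply/matrixP=> i j; rewrite mxE AE.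
  under eq_bigr => k _ do rewrite mxE.
  rewrite sumS mxE; under eq_bigr => k _ do rewrite !mxE mulrC.
  by rewrite sumS.
rewrite char_poly_mulmxC; congr (char_poly _ * _).
(* S^T S is diagonal, since fibres are disjoint; its entry at [j] is the size of the fibre of [c]
   over [j]. *)
apply/matrixP=> i j; rewrite -mulmxA !mxE (bigD1 j) //=.
rewrite big1 ?addr0 => [|k kj]; rewrite !mxE.
  rewrite -sum1_card -mulr_natr natr_sum [in RHS]big_mkcond /=; congr (_ * _).
  by apply: eq_bigr => k _; rewrite !mxE inE; case: eqP => _;
    rewrite ?mulr1 ?mulr0.
rewrite big1 ?mulr0 // => l _; rewrite !mxE.
by case: eqP => [->|_]; rewrite ?mul0r // (negPf kj) mulr0.
Qed.

(** * Determinants that compute *)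

(* Laplace expansion along the first row, in a form that reduces on concrete
   arguments. *)
Fixpoint laplace (F : pzRingType) (n : nat) (f : nat -> nat -> F) : F :=
  if n is n'.+1 then
    foldr +%R 0 [seq f 0%N j * ((-1) ^+ j *
                   laplace n' (fun i k => f i.+1 (bump j k))) | j <- iota 0 n]
  else 1.

Lemma det_laplace (F : comNzRingType) (n : nat) (f : nat -> nat -> F) :
  \det (\matrix_(i < n, j < n) f i j) = laplace n f.
Proof.
elim: n f => [|n IHn] f; first by rewrite det_mx00.
rewrite (expand_det_row _ ord0) /laplace -/laplace foldrE big_map.
rewrite -[X in iota _ X]subn0 -/(index_iota 0 n.+1) big_mkord.
apply: eq_bigr => j _; rewrite mxE /cofactor add0n -IHn.
by congr (_ * (_ * \det _)); apply/matrixP=> i k; rewrite !mxE.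
Qed.

Lemma eq_laplace (F : comNzRingType) (n : nat) (f g : nat -> nat -> F) :
  (forall i j, (i < n)%N -> (j < n)%N -> f i j = g i j) ->
  laplace n f = laplace n g.
Proof.
move=> fg; rewrite -!det_laplace; congr (\det _).
by apply/matrixP => i j; rewrite !mxE fg.
Qed.

Definition rows_mx (F : pzRingType) (rows : seq (seq F)) (i j : nat) : F :=
  nth 0 (nth [::] rows i) j.

(** * Labels for annihilator classes *)

(* [lab] names the annihilator classes of R by elements of [S]; [z] is the name
   of the class of 0, [adj] says which classes have product 0, and [wt] is the
   class size.  That distinct labels have distinct annihilators is not part of
   the record: it is decided by computation on [S] in [eq_ann_label]. *)
Record zd_labelling (R : finComNzRingType) (T : eqType) (lab : R -> T)
    (S : seq T) (z : T) (adj : rel T) (wt : T -> nat) : Prop := {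
  labels_uniq : uniq S;
  label_mem x : lab x \in S;
  label_eq0 x : (lab x == z) = (x == 0);
  label_adj x y : (x * y == 0) = adj (lab x) (lab y);
  label_card t : t \in S -> #|[set x | lab x == t]| = wt t;
  label_wt t : t \in S -> (0 < wt t)%N
}.

(** Multiplication is componentwise, and a fibre of the pair of labels is a product of two
    fibres. *)
Lemma zd_labelling_prod (R R' : finComNzRingType) (T T' : eqType)
    (lab : R -> T) (lab' : R' -> T') S S' z z' adj adj' wt wt' :
  zd_labelling lab S z adj wt -> zd_labelling lab' S' z' adj' wt' ->
  zd_labelling (fun x : R * R' => (lab x.1, lab' x.2))
    [seq (t, t') | t <- S, t' <- S'] (z, z')
    (fun t u => adj t.1 u.1 && adj' t.2 u.2)
    (fun t => wt t.1 * wt' t.2)%N.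
Proof.
move=> [S1 S2 S3 S4 S5 S6] [S1' S2' S3' S4' S5' S6']; split.
- by apply: allpairs_uniq => // -[t t'] [u u'].
- by move=> x; apply/allpairsP; exists (lab x.1, lab' x.2); rewrite S2 S2'.
- by move=> [x x']; rewrite !xpair_eqE /= S3 S3'.
- by move=> [x x'] [y y']; rewrite xpair_eqE /= -S4 -S4'.
- move=> _ /allpairsP[[t t'] /= [tS tS' ->]]; rewrite -S5 // -S5' // -cardsX.
  by apply: eq_card => -[x x']; rewrite !inE.
- by move=> _ /allpairsP[[t t'] /= [tS tS' ->]]; rewrite muln_gt0 S6 ?S6'.
Qed.

(** * Valuations in Z_(p^n) *)

Lemma card_dvdn_Zp (N d : nat) : (1 < N)%N -> (d %| N)%N ->
  #|[set x : 'Z_N | (d %| x)%N]| = (N %/ d)%N.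
Proof.
move=> N1 dN; have N0 : (0 < N)%N by apply: ltnW.
have d0 : (0 < d)%N by apply: dvdn_gt0 dN.
(* The multiples of [d] are the [d * k]. The bound of the ordinal type ['Z_N] is [(Zp_trunc N).+2],
   which equals [N] since 1 < N. *)
have mul_lt (k : 'I_(N %/ d)) : (d * k < (Zp_trunc N).+2)%N.
  by rewrite Zp_cast // -[X in (_ < X)%N](divnK dN) mulnC ltn_pmul2r.
pose f k : 'Z_N := Ordinal (mul_lt k).
have injf : injective f.
  move=> k l /(congr1 val) /= /eqP.
  by rewrite eqn_pmul2l // => /eqP kl; apply: val_inj.
rewrite -[RHS]card_ord -(card_imset _ injf); apply: eq_card => x.
rewrite inE; apply/idP/imsetP => [dx|[k _ ->]]; last exact: dvdn_mulr.
have xk : (x %/ d < N %/ d)%N.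
  by rewrite ltn_divLR // divnK // -[X in (_ < X)%N](Zp_cast N1).
by exists (Ordinal xk) => //; apply: val_inj; rewrite /= mulnC divnK.
Qed.

Section PrimePower.

Variables (p n : nat).
Hypotheses (p_pr : prime p) (n_gt0 : (0 < n)%N).

(** As [logn p 0] is 0, zero would be confused with the units; the value [n] makes it the top of the
    valuation. *)
Definition Zp_val (x : 'Z_(p ^ n)) : nat := if x == 0 then n else logn p x.

Let pn_gt1 : (1 < p ^ n)%N.
Proof. by rewrite -(exp1n n) ltn_exp2r // prime_gt1. Qed.

Let ltx (x : 'Z_(p ^ n)) : (x < p ^ n)%N.
Proof. by rewrite -[X in (_ < X)%N](Zp_cast pn_gt1). Qed.

Let x_gt0 (x : 'Z_(p ^ n)) : x != 0 -> (0 < x)%N.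
Proof. by rewrite lt0n. Qed.

Lemma dvdn_Zp_val (i : nat) (x : 'Z_(p ^ n)) :
  (i <= n)%N -> (p ^ i %| x)%N = (i <= Zp_val x)%N.
Proof.
rewrite /Zp_val; have [-> /=|x0] := eqVneq x 0; first by rewrite dvdn0.
by rewrite pfactor_dvdn // x_gt0.
Qed.

Lemma Zp_val_lt (x : 'Z_(p ^ n)) : x != 0 -> (Zp_val x < n)%N.
Proof.
by move=> x0; rewrite ltnNge -dvdn_Zp_val // gtnNdvd ?x_gt0 ?ltx.
Qed.

Lemma Zp_val_eq (x : 'Z_(p ^ n)) : (Zp_val x == n) = (x == 0).
Proof.
have [->|/Zp_val_lt] := eqVneq x 0; first by rewrite /Zp_val !eqxx.
by rewrite ltn_neqAle => /andP[/negPf].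
Qed.

Lemma Zp_val_le (x : 'Z_(p ^ n)) : (Zp_val x <= n)%N.
Proof. by rewrite leq_eqVlt Zp_val_eq; case: eqVneq => //= /Zp_val_lt. Qed.

Lemma mul_eq0_Zp_val (x y : 'Z_(p ^ n)) :
  (x * y == 0) = (n <= Zp_val x + Zp_val y)%N.
Proof.
have [x0|x0] := eqVneq x 0.
  by rewrite x0 mul0r eqxx /Zp_val eqxx leq_addr.
have [y0|y0] := eqVneq y 0.
  by rewrite y0 mulr0 eqxx /Zp_val eqxx leq_addl.
(* Valuations of non-zero representatives add up, and the product is zero iff p^n divides the
   product of the representatives. *)
rewrite /Zp_val (negPf x0) (negPf y0) -lognM ?x_gt0 //.
rewrite -pfactor_dvdn ?muln_gt0 ?x_gt0 // -val_eqE /=.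
by rewrite [X in (_ %% X)%N](Zp_cast pn_gt1).
Qed.

(** Elements of valuation at least i, minus those of valuation at least i + 1. The factor [i < n]
    matters at [i = n], where truncated subtraction would give 1 - 1 instead of 1. *)
Definition Zp_wt (i : nat) : nat :=
  (p ^ (n - i) - (i < n) * p ^ (n - i.+1))%N.

Lemma card_Zp_val (i : nat) : (i <= n)%N ->
  #|[set x : 'Z_(p ^ n) | Zp_val x == i]| = Zp_wt i.
Proof.
rewrite /Zp_wt leq_eqVlt => /predU1P[->|i_lt].
  rewrite ltnn subnn subn0 expn0 -(cards1 (0 : 'Z_(p ^ n))).
  by apply: eq_card => x; rewrite !inE Zp_val_eq.
have card_ge j : (j <= n)%N ->
    #|[set x : 'Z_(p ^ n) | (j <= Zp_val x)%N]| = (p ^ (n - j))%N.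
  move=> j_le; rewrite expnB ?prime_gt0 // -card_dvdn_Zp ?dvdn_exp2l //.
  by apply: eq_card => x; rewrite !inE dvdn_Zp_val.
rewrite i_lt mul1n -!card_ge // 1?ltnW // -cardsDS.
  by apply: eq_card => x; rewrite !inE -leqNgt eqn_leq andbC andbC.
by apply/subsetP => x; rewrite !inE; apply: ltnW.
Qed.

Lemma zd_labelling_Zp :
  zd_labelling Zp_val (iota 0 n.+1) n (fun i j => n <= i + j)%N Zp_wt.
Proof.
split.
- exact: iota_uniq.
- by move=> x; rewrite mem_iota ltnS Zp_val_le.
- exact: Zp_val_eq.
- exact: mul_eq0_Zp_val.
- by move=> i; rewrite mem_iota ltnS; apply: card_Zp_val.
- move=> i; rewrite mem_iota ltnS /Zp_wt => i_le; rewrite subn_gt0.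
  case: (ltnP i n) => i_lt; last by rewrite mul0n expn_gt0 prime_gt0.
  by rewrite mul1n ltn_exp2l ?prime_gt1 // ltn_sub2l.
Qed.

End PrimePower.

(** * Annihilator classes and zero-divisors *)

Lemma eq_ann_class (R : finComNzRingType) (x y : R) :
  (ann_class x == ann_class y) = (ann x == ann y).
Proof.
apply/eqP/eqP => [xy|xy]; last by apply/setP => t; rewrite !inE xy.
have : y \in ann_class y by rewrite inE.
by rewrite -xy inE => /eqP.
Qed.

(** Only 0 is annihilated by 1, so the class of 0 is a singleton; ann(1) is zero, so the class of 1
    consists of the regular elements. *)
Lemma czd_verticesE (R : finComNzRingType) :
  czd_vertices R = [set ann_class x | x in zd_vertices R].
Proof.
have annE (a b : R) : (b \in ann a) = (a * b == 0) by rewrite inE.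
apply/setP => C; rewrite in_setD in_set2; apply/andP/imsetP.
  move=> [/norP[C0 C1] /imsetP[x _ CE]]; exists x => //.
  rewrite inE; apply/andP; split.
    by apply: contra C0 => /eqP x0; rewrite CE x0.
  apply: contraR C1; rewrite negb_exists => /forallP x_reg.
  rewrite CE eq_ann_class; apply/eqP/setP => t; rewrite !annE mul1r.
  have [->|t0] := eqVneq t 0; first by rewrite mulr0 eqxx.
  by apply/negbTE; have := x_reg t; rewrite t0.
move=> [x]; rewrite inE => /andP[x0 /existsP[y /andP[y0 xy]]] ->.
split; last exact: imset_f.
rewrite !eq_ann_class; apply/norP; split.
  by apply: contra x0 => /eqP/setP/(_ 1); rewrite !annE mul0r mulr1 eqxx.
by apply: contra y0 => /eqP/setP/(_ y); rewrite !annE xy mul1r.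
Qed.

(** Turns a [uniq] test, decidable by computation, into injectivity. *)
Lemma uniq_map_inj_in (T1 T2 : eqType) (f : T1 -> T2) (s : seq T1) :
  uniq (map f s) -> {in s &, injective f}.
Proof.
elim: s => //= a s IHs /andP[/negP fa us] x y; rewrite !inE.
move=> /predU1P[->|xs] /predU1P[->|ys] // fxy; last exact: IHs.
  by case: fa; rewrite fxy map_f.
by case: fa; rewrite -fxy map_f.
Qed.

(** * Both characteristic polynomials in terms of labels *)

Section LabelledRing.

Variables (R : finComNzRingType) (T : eqType) (lab : R -> T) (S : seq T) (z : T).
Variables (adj : rel T) (wt : T -> nat).
Hypothesis labP : zd_labelling lab S z adj wt.

Lemma label_surj (t : T) : t \in S -> exists x, lab x = t.
Proof.
move=> tS; have := label_wt labP tS; rewrite -(label_card labP tS).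
by case/card_gt0P=> x; rewrite inE => /eqP; exists x.
Qed.

(** The zero-divisor condition is tested on labels alone, so the list can be computed while the
    primes stay symbolic. *)
Definition vertex_labels : seq T :=
  [seq t <- S | (t != z) && has (fun u => (u != z) && adj t u) S].

Local Notation m := (size vertex_labels).

Lemma label_vertex (x : R) : (lab x \in vertex_labels) = (x \in zd_vertices R).
Proof.
rewrite mem_filter (label_mem labP) andbT inE (label_eq0 labP).
congr (_ && _); apply/hasP/existsP => [[t /label_surj[y <-]]|[y /andP[y0 xy]]].
  by rewrite (label_eq0 labP) -(label_adj labP); exists y.
exists (lab y); first exact: label_mem labP y.
by rewrite (label_eq0 labP) y0 -(label_adj labP).
Qed.

Definition label_mx : 'M[int]_m :=
  \matrix_(i, j) (if adj (nth z vertex_labels i) (nth z vertex_labels j)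
                  then (wt (nth z vertex_labels j))%:R else 0).

Lemma label_index_subproof (x : R) :
  x \in zd_vertices R -> (index (lab x) vertex_labels < m)%N.
Proof. by rewrite index_mem label_vertex. Qed.

Definition label_index (x : R) (xV : x \in zd_vertices R) : 'I_m :=
  Ordinal (label_index_subproof xV).

Lemma nth_label_index (x : R) (xV : x \in zd_vertices R) :
  nth z vertex_labels (label_index xV) = lab x.
Proof. by rewrite nth_index // label_vertex. Qed.

Lemma uniq_vertex_labels : uniq vertex_labels.
Proof. exact: filter_uniq (labels_uniq labP). Qed.

Lemma label_index_eq (x : R) (xV : x \in zd_vertices R) (j : 'I_m) :
  (label_index xV == j) = (lab x == nth z vertex_labels j).
Proof.
by rewrite -(nth_label_index xV) nth_uniq ?uniq_vertex_labels.
Qed.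

Lemma nth_vertex_label (j : 'I_m) :
  exists2 x, x \in zd_vertices R & lab x = nth z vertex_labels j.
Proof.
have jV : nth z vertex_labels j \in vertex_labels by exact: mem_nth.
have /label_surj[x xj] : nth z vertex_labels j \in S.
  by move: jV; rewrite mem_filter => /andP[].
by exists x; rewrite // -label_vertex xj.
Qed.

Lemma card_vertex_label (j : 'I_m) :
  #|[set x | lab x == nth z vertex_labels j]| = wt (nth z vertex_labels j).
Proof.
apply: label_card labP _ _; have [x _ <-] := nth_vertex_label j.
exact: label_mem labP x.
Qed.

(** Ensures that the exponent in [char_poly_zd_mx] is not a truncated difference. *)
Lemma leq_card_vertex_labels : (m <= #|zd_vertices R|)%N.
Proof.
pose c (i : 'I_#|zd_vertices R|) := label_index (enum_valP i).
have <- : #|[set c i | i in 'I_#|zd_vertices R|]| = m.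
  rewrite -[RHS]card_ord; apply: eq_card => j; rewrite [RHS]inE.
  have [x xV xj] := nth_vertex_label j; apply/imsetP.
  exists (enum_rank_in xV x) => //; apply/esym/eqP.
  by rewrite label_index_eq enum_rankK_in // xj.
by rewrite -[X in (_ <= X)%N]card_ord leq_imset_card.
Qed.

Lemma char_poly_zd_mx :
  char_poly (zd_mx R) = char_poly label_mx * 'X^(#|zd_vertices R| - m).
Proof.
pose c (i : 'I_#|zd_vertices R|) := label_index (enum_valP i).
pose B : 'M[int]_m :=
  \matrix_(i, j) (adj (nth z vertex_labels i) (nth z vertex_labels j))%:R.
apply: (mulIf (monic_neq0 (monicXn _ m))).
rewrite -mulrA -exprD subnK ?leq_card_vertex_labels //.
rewrite (@char_poly_fibers _ _ _ c _ B) => [|i j]; last first.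
  by rewrite !mxE !nth_label_index -(label_adj labP).
congr (char_poly _ * _); apply/matrixP => i j; rewrite !mxE.
(* Every element with a vertex label is a vertex, so the fibre is a whole class. *)
suff -> : #|[set k | c k == j]| = wt (nth z vertex_labels j).
  by case: adj; rewrite ?mul0rn.
rewrite -card_vertex_label -(card_imset _ enum_val_inj).
apply: eq_card => x; rewrite [RHS]inE; apply/imsetP/idP => [[k]|xj].
  by rewrite inE label_index_eq => kj ->.
have xV : x \in zd_vertices R by rewrite -label_vertex (eqP xj) mem_nth.
exists (enum_rank_in xV x); last by rewrite enum_rankK_in.
by rewrite inE label_index_eq enum_rankK_in.
Qed.

Lemma char_poly_label_mx :
  char_poly label_mx =
  laplace m (fun i j => 'X *+ (i == j) -
    (if adj (nth z vertex_labels i) (nth z vertex_labels j)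
     then (wt (nth z vertex_labels j))%:R else 0)%:P).
Proof.
rewrite -det_laplace; congr (\det _).
by apply/matrixP => i j; rewrite !mxE.
Qed.

Hypothesis sepS : uniq [seq [seq adj t u | u <- S] | t <- S].

(** All labels in [S] are attained, so the row of [lab x] in the table of [adj] determines ann(x);
    [sepS] says that these rows differ. *)
Lemma eq_ann_label (x y : R) : (ann x == ann y) = (lab x == lab y).
Proof.
apply/eqP/eqP=> xy.
  apply: (uniq_map_inj_in sepS); rewrite ?(label_mem labP) //.
  apply/eq_in_map => _ /label_surj[t <-]; rewrite -!(label_adj labP).
  by have /setP/(_ t) := xy; rewrite !inE.
by apply/setP => t; rewrite !inE !(label_adj labP) xy.
Qed.

(** Representatives give a bijection [c] from classes to vertex labels. Applying [char_poly_fibers]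
    with singleton fibres reindexes the matrix without a cast between its two orders. *)
Lemma char_poly_czd_mx : char_poly (czd_mx R) = char_poly label_mx.
Proof.
have /fin_all_exists2[r rV rE] (i : 'I_#|czd_vertices R|) :
    exists2 x, x \in zd_vertices R & enum_val i = ann_class x.
  move: (enum_val i) (enum_valP i) => C; rewrite czd_verticesE.
  by case/imsetP => x xV xE; exists x.
pose c i := label_index (rV i).
have c_surj j : exists i, c i = j.
  have [x xV xj] := nth_vertex_label j.
  have CV : ann_class x \in czd_vertices R by rewrite czd_verticesE imset_f.
  exists (enum_rank_in CV (ann_class x)); apply/eqP.
  by rewrite label_index_eq -xj -eq_ann_label -eq_ann_class -rE enum_rankK_in.
have c_inj : injective c.
  move=> i j /eqP; rewrite label_index_eq nth_label_index -eq_ann_label.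
  by rewrite -eq_ann_class -!rE => /eqP/enum_val_inj.
have [g gK] := fin_all_exists c_surj.
have mE : #|czd_vertices R| = m.
  rewrite -[LHS]card_ord -[RHS]card_ord; apply: (@bij_eq_card _ _ c).
  by exists g => // i; apply: c_inj; rewrite gK.
apply: (mulIf (monic_neq0 (monicXn _ m))).
rewrite (@char_poly_fibers _ _ _ c _ label_mx) => [|i j].
  congr (char_poly _ * 'X^_); last exact: mE; apply/matrixP => i j; rewrite mxE.
  suff -> : #|[set k | c k == j]| = 1%N by [].
  apply/eqP/cards1P; exists (g j); apply/setP => k; rewrite !inE.
  by rewrite -(inj_eq c_inj) gK.
rewrite !mxE !nth_label_index !rE czd_adj_class (label_adj labP).
case: ifP => // _; congr (_%:R).
rewrite -[in RHS](nth_label_index (rV j)) -card_vertex_label nth_label_index.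
by apply: eq_card => x; rewrite !inE eq_ann_label eq_sym.
Qed.

End LabelledRing.

(** * The two rings of the theorem *)

(* Here a = p - 1 and b = q - 1. *)
Lemma laplace_ppq (F : comNzRingType) (x a b : F) :
  laplace 6 (rows_mx
    [:: [:: x; 0; 0; 0; 0; - b];
        [:: 0; x; 0; 0; - a; 0];
        [:: 0; 0; x; - (a * b); - a; - b];
        [:: 0; 0; - a; x; 0; 0];
        [:: 0; - (a * b); - a; 0; x; - b];
        [:: - (a * a); 0; - a; 0; - a; x]]) =
  - (a ^+ 6 * b ^+ 3) + a ^+ 3 * b * (a + 2 * b + 3 * (a * b)) * x ^+ 2
  - 2 * a ^+ 2 * b * x ^+ 3 - a * (a + 2 * b + 3 * (a * b)) * x ^+ 4 + x ^+ 6.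
Proof. by rewrite /laplace /rows_mx /=; ring. Qed.

(* Here a = p - 1 and b = p. *)
Lemma laplace_p2p (F : comNzRingType) (x a b : F) :
  laplace 4 (rows_mx
    [:: [:: x; 0; 0; - a];
        [:: 0; x; - a; 0];
        [:: 0; - (a * a); x - a; - a];
        [:: - (b * a); 0; - a; x]]) =
  b * a ^+ 5 + b * a ^+ 3 * x - (b * a ^+ 2 + a ^+ 2 + a ^+ 3) * x ^+ 2
  - a * x ^+ 3 + x ^+ 4.
Proof. by rewrite /laplace /rows_mx /=; ring. Qed.


Lemma Zp_wt_max (p n : nat) : Zp_wt p n n = 1%N.
Proof. by rewrite /Zp_wt ltnn subnn subn0. Qed.

Lemma Zp_wt_lt (p n i : nat) : (0 < p)%N -> (i < n)%N ->
  (Zp_wt p n i)%:R = (p%:Z - 1) * p%:Z ^+ (n - i.+1).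
Proof.
move=> p0 i_lt; rewrite /Zp_wt i_lt mul1n natrB ?leq_pexp2l ?leq_sub2l //.
by rewrite -(subnSK i_lt) !natrX natz exprS mulrBl mul1r.
Qed.

Theorem mainTheorem9 (p q : nat) (hp : prime p) (hq : prime q) (hpq : p <> q) :
  let P := p%:Z in
  let Q := q%:Z in
  let f : {poly int} :=
    (- ((P - 1) ^+ 6 * (Q - 1) ^+ 3))%:P
    + ((P - 1) ^+ 3 * (Q - 1) * (P * (3 * Q - 2) - Q)) *: 'X^2
    - (2 * (P - 1) ^+ 2 * (Q - 1)) *: 'X^3
    - ((P - 1) * (P * (3 * Q - 2) - Q)) *: 'X^4
    + 'X^6 in
  let g : {poly int} :=
    ((P - 1) ^+ 5 * P)%:P
    + ((P - 1) ^+ 3 * P) *: 'X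
    - (2 * (P - 1) ^+ 2 * P) *: 'X^2
    - (P - 1) *: 'X^3
    + 'X^4 in
  (char_poly (czd_mx ('Z_p * 'Z_p * 'Z_q)%type) = f
   /\ exists k : nat, char_poly (zd_mx ('Z_p * 'Z_p * 'Z_q)%type) = f * 'X^k)
  /\
  (char_poly (czd_mx ('Z_(p ^ 2) * 'Z_p)%type) = g
   /\ exists k : nat, char_poly (zd_mx ('Z_(p ^ 2) * 'Z_p)%type) = g * 'X^k).

Proof.
have p_gt0 := prime_gt0 hp; have q_gt0 := prime_gt0 hq.
move=> P Q f g.
(* Z_p is read as Z_(p^1): label 0 marks the units and label 1 marks zero. *)
have Lp : zd_labelling (R := 'Z_p) (@Zp_val p 1) _ _ _ _ :=
  zd_labelling_Zp hp (ltn0Sn 0).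
pose a := (P - 1)%:P; pose b := (Q - 1)%:P.
have Zp_wt1 r : (0 < r)%N -> (Zp_wt r 1 0)%:R = r%:Z - 1.
  by move=> r0; rewrite Zp_wt_lt // mulr1.
split.
  have Lq : zd_labelling (R := 'Z_q) (@Zp_val q 1) _ _ _ _ :=
    zd_labelling_Zp hq (ltn0Sn 0).
  have L := zd_labelling_prod (zd_labelling_prod Lp Lp) Lq.
  (* The separation hypothesis [sepS] is settled here by evaluation on the finite list of labels. *)
  rewrite (char_poly_czd_mx L) // (char_poly_zd_mx L).
  set M := char_poly _; suff -> : M = f by split => //; eexists.
  rewrite /M char_poly_label_mx; set vl := vertex_labels _ _ _.
  (* Of the 8 labels, (0,0,0) is the class of units and (1,1,1) that of zero. *)
  have -> : vl = [:: (0, 0, 1); (0, 1, 0); (0, 1, 1);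
                     (1, 0, 0); (1, 0, 1); (1, 1, 0)]%N by vm_compute.
  transitivity (laplace 6 (rows_mx
    [:: [:: 'X; 0; 0; 0; 0; - b];
        [:: 0; 'X; 0; 0; - a; 0];
        [:: 0; 0; 'X; - (a * b); - a; - b];
        [:: 0; 0; - a; 'X; 0; 0];
        [:: 0; - (a * b); - a; 0; 'X; - b];
        [:: - (a * a); 0; - a; 0; - a; 'X]])).
    apply: eq_laplace => i j.
    do 6?[case: i => [|i]]; do 6?[case: j => [|j]] => //= _ _;
      rewrite /rows_mx /= ?Zp_wt_max ?muln1 ?mul1n ?natrM ?Zp_wt1 //
        ?polyC0 ?polyCM ?mulr1n ?mulr0n ?subr0 ?sub0r //.
  (* With a = p - 1 and b = q - 1, a + 2b + 3ab = p(3q - 2) - q. *)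
  by rewrite laplace_ppq /f -!mul_polyC /a /b; ring.
have Lpp : zd_labelling (R := 'Z_(p ^ 2)) (@Zp_val p 2) _ _ _ _ :=
  zd_labelling_Zp hp (ltn0Sn 1).
have L := zd_labelling_prod Lpp Lp.
rewrite (char_poly_czd_mx L) // (char_poly_zd_mx L).
set M := char_poly _; suff -> : M = g by split => //; eexists.
rewrite /M char_poly_label_mx; set vl := vertex_labels _ _ _.
(* The class sizes are p(p - 1), (p - 1)^2, p - 1 and p - 1; only (1,1) carries a loop. *)
have -> : vl = [:: (0, 1); (1, 0); (1, 1); (2, 0)]%N by vm_compute.
transitivity (laplace 4 (rows_mx
  [:: [:: 'X; 0; 0; - a];
      [:: 0; 'X; - a; 0];
      [:: 0; - (a * a); 'X - a; - a];
      [:: - (P%:P * a); 0; - a; 'X]])).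
  have Zp_wt20 : (Zp_wt p 2 0)%:R = P * (P - 1) by rewrite Zp_wt_lt // mulrC.
  have Zp_wt21 : (Zp_wt p 2 1)%:R = P - 1 by rewrite Zp_wt_lt // mulr1.
  apply: eq_laplace => i j.
  do 4?[case: i => [|i]]; do 4?[case: j => [|j]] => //= _ _;
    rewrite /rows_mx /= ?Zp_wt_max ?muln1 ?mul1n ?natrM ?Zp_wt20 ?Zp_wt21
      ?Zp_wt1 // ?polyC0 ?polyCM ?mulr1n ?mulr0n ?subr0 ?sub0r //.
(* With a = p - 1, p a^2 + a^2 + a^3 = 2 p a^2. *)
by rewrite laplace_p2p /g -!mul_polyC /a; ring.
Qed.
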